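(* Let $I$ be a set and let $A=\langle A;\cdot,0,(\Diamond_i)_{i\in I},(d_{i,k})_{i,k\in I}\rangle$ be an $I$-dimensional cylindric quasi-implication algebra. Then its $I$-dimensional Goldblatt frame $X^G_A=\langle\mathfrak{F}(A);\perp^G,(R^G_i)_{i\in I},(\Delta^G_{i,k})_{i,k\in I}\rangle$ is an $I$-dimensional cylindric orthoframe.
   Context: A quasi-implication algebra is a set $A$ with a binary operation $\cdot$ satisfying (1) $(x\cdot y)\cdot x=x$; (2) $(x\cdot y)\cdot(x\cdot z)=(y\cdot x)\cdot(y\cdot z)$; (3) $((x\cdot y)\cdot(y\cdot x))\cdot x=((y\cdot x)\cdot(x\cdot y))\cdot y$. In any quasi-implication algebra $x\cdot x=y\cdot y$ for all $x,y$, and one sets $1:=x\cdot x$. A bounded quasi-implication algebra is a quasi-implication algebra with a constant $0$ such that $0\cdot x=1$ for all $x$. A monadic quasi-implication algebra $\langle A;\cdot,0,\Diamond\rangle$ is a bounded quasi-implication algebra $\langle A;\cdot,0\rangle$ with a unary operation $\Diamond$ satisfying: (a) $\Diamond\Diamond x\cdot\Diamond x=1$ and $x\cdot\Diamond x=1$; (b) $\Diamond(\Diamond x\cdot 0)=\Diamond x\cdot 0$ and $\Diamond 0=0$; (c) $\Diamond(((x\cdot 0)\cdot(y\cdot 0))\cdot x)=((\Diamond x\cdot 0)\cdot(\Diamond y\cdot 0))\cdot\Diamond x$. ($\Diamond$ binds more tightly than $\cdot$.) An $I$-dimensional cylindric quasi-implication algebra is a structure $\langle A;\cdot,0,(\Diamond_i)_{i\in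 I},(d_{i,k})_{i,k\in I}\rangle$, with $d_{i,k}\in A$, such that: (1) $\langle A;\cdot,0,\Diamond_i\rangle$ is a monadic quasi-implication algebra for all $i\in I$; (2) $\Diamond_i\Diamond_k x=\Diamond_k\Diamond_i x$ for all $i,k\in I$ and $x\in A$; (3) $d_{i,k}=d_{k,i}$ and $d_{i,i}=1$ for all $i,k\in I$; (4) if $i\ne k$ and $l\neq k$ then $\Diamond_k(((d_{i,k}\cdot d_{k,l})\cdot(d_{i,k}\cdot 0))\cdot 0)=d_{i,l}$. A filter on a bounded quasi-implication algebra $A$ is a non-empty $\alpha\subseteq A$ such that (1) $x\in\alpha$ and $x\cdot y=1$ imply $y\in\alpha$; (2) $x,y\in\alpha$ imply $((x\cdot y)\cdot(x\cdot 0))\cdot 0\in\alpha$. It is proper if $0\notin\alpha$. $\mathfrak{F}(A)$ denotes the set of all proper filters of $A$; $\Diamond_i[\alpha]=\{\Diamond_i x: x\in\alpha\}$; $\phi(x)=\{\alpha\in\mathfrak{F}(A): x\in\alpha\}$ for $x\in A$. The $I$-dimensional Goldblatt frame $X^G_A$ has underlying set $\mathfrak{F}(A)$ and, for $\alpha,\beta\in\mathfrak{F}(A)$ and $i,k\in I$: $\alpha\perp^G\beta$ iff there is $x\in A$ with $x\in\alpha$ and $x\cdot 0\in\beta$; $\alpha R^G_i\beta$ iff $\Diamond_i[\alpha]\subseteq\beta$; $\Delta^G_{i,k}=\phi(d_{i,k})$. An orthoframe is a pair $\langle X;\perp\rangle$ with $X$ a set and $\perp\subseteq X^2$ irreflexive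 and symmetric; for $U\subseteq X$, $U^\perp=\{x\in X: x\perp y\text{ for all }y\in U\}$. For a binary relation $R$ on $X$ and $U\subseteq X$, $R[U]=\{y\in X: xRy\text{ for some }x\in U\}$. A monadic orthoframe is a triple $\langle X;\perp,R\rangle$ such that $\langle X;\perp\rangle$ is an orthoframe, $R$ is a reflexive and transitive binary relation on $X$, and $R[R[\{x\}]^\perp]\subseteq R[\{x\}]^\perp$ for all $x\in X$. An $I$-dimensional cylindric orthoframe is a structure $\langle X;\perp,(R_i)_{i\in I},(\Delta_{i,k})_{i,k\in I}\rangle$ such that for all $i,k,l\in I$: (1) $\langle X;\perp,R_i\rangle$ is a monadic orthoframe; (2) $R_i\circ R_k=R_k\circ R_i$ (composition of relations); (3) $\Delta_{i,k}\subseteq X$ with $\Delta_{i,k}=\Delta_{k,i}=\Delta_{i,k}^{\perp\perp}$ and $\Delta_{i,i}=X$; (4) if $i\ne k$ and $l\neq k$, then $R_k[\Delta_{i,k}\cap\Delta_{k,l}]=\Delta_{i,l}$. *)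

(* Defs.v *)
From mathcomp Require Import all_boot.
From mathcomp Require Import classical_sets.
Set Implicit Arguments. Unset Strict Implicit. Unset Printing Implicit Defensive.
Local Open Scope classical_set_scope.

Section QuasiImplicationAlgebras.
Context {A : Type} (op : A -> A -> A) (zero : A).
Local Notation "x ⋅ y" := (op x y) (at level 40, left associativity).

Definition quasi_implication_algebra : Prop :=
  [/\ (forall x y, (x ⋅ y) ⋅ x = x),
      (forall x y z, (x ⋅ y) ⋅ (x ⋅ z) = (y ⋅ x) ⋅ (y ⋅ z))
    & (forall x y, ((x ⋅ y) ⋅ (y ⋅ x)) ⋅ x = ((y ⋅ x) ⋅ (x ⋅ y)) ⋅ y)].

(* In a quasi-implication algebra x ⋅ x does not depend on x, and 1 is by
   definition this common value; we take the instance x := 0. *)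
Definition qone : A := zero ⋅ zero.

Definition bounded_quasi_implication_algebra : Prop :=
  quasi_implication_algebra /\ (forall x, zero ⋅ x = qone).

Definition monadic_quasi_implication_algebra (dia : A -> A) : Prop :=
  [/\ bounded_quasi_implication_algebra,
      (forall x, dia (dia x) ⋅ dia x = qone /\ x ⋅ dia x = qone),
      (forall x, dia (dia x ⋅ zero) = dia x ⋅ zero),
      dia zero = zero
    & (forall x y, dia (((x ⋅ zero) ⋅ (y ⋅ zero)) ⋅ x) =
         ((dia x ⋅ zero) ⋅ (dia y ⋅ zero)) ⋅ dia x)].

Definition cylindric_quasi_implication_algebra (I : Type)
    (dia : I -> A -> A) (d : I -> I -> A) : Prop :=
  [/\ (forall i, monadic_quasi_implication_algebra (dia i)),
      (forall i k x, dia i (dia k x) = dia k (dia i x)),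
      (forall i k, d i k = d k i),
      (forall i, d i i = qone)
    & (forall i k l, i <> k -> l <> k ->
         dia k (((d i k ⋅ d k l) ⋅ (d i k ⋅ zero)) ⋅ zero) = d i l)].

Definition qfilter (F : set A) : Prop :=
  [/\ F !=set0,
      (forall x y, F x -> x ⋅ y = qone -> F y)
    & (forall x y, F x -> F y -> F (((x ⋅ y) ⋅ (x ⋅ zero)) ⋅ zero))].

Definition proper_qfilter (F : set A) : Prop := qfilter F /\ ~ F zero.

Definition proper_qfilters : Type := {F : set A | proper_qfilter F}.

Definition phi (x : A) : set proper_qfilters := [set F | sval F x].

Definition goldblatt_perp (F G : proper_qfilters) : Prop :=
  exists x, sval F x /\ sval G (x ⋅ zero).

Definition goldblatt_rel (I : Type) (dia : I -> A -> A) (i : I)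
    (F G : proper_qfilters) : Prop :=
  dia i @` sval F `<=` sval G.

Definition goldblatt_diag (I : Type) (d : I -> I -> A) (i k : I) :
    set proper_qfilters :=
  phi (d i k).

End QuasiImplicationAlgebras.

Section Orthoframes.
Context {X : Type} (perp : X -> X -> Prop).

Definition orthoframe : Prop :=
  (forall x, ~ perp x x) /\ (forall x y, perp x y -> perp y x).

Definition orthocompl (U : set X) : set X :=
  [set x | forall y, U y -> perp x y].

Definition rel_image (R : X -> X -> Prop) (U : set X) : set X :=
  [set y | exists2 x, U x & R x y].

Definition rel_comp (R S : X -> X -> Prop) : X -> X -> Prop :=
  fun x z => exists2 y, R x y & S y z.

Definition monadic_orthoframe (R : X -> X -> Prop) : Prop :=
  [/\ orthoframe,
      (forall x, R x x),
      (forall x y z, R x y -> R y z -> R x z)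
    & (forall x, rel_image R (orthocompl (rel_image R [set x])) `<=`
         orthocompl (rel_image R [set x]))].

Definition cylindric_orthoframe (I : Type) (R : I -> X -> X -> Prop)
    (Delta : I -> I -> set X) : Prop :=
  [/\ (forall i, monadic_orthoframe (R i)),
      (forall i k, rel_comp (R i) (R k) = rel_comp (R k) (R i)),
      (forall i k, Delta i k = Delta k i /\
         Delta k i = orthocompl (orthocompl (Delta i k))),
      (forall i, Delta i i = setT)
    & (forall i k l, i <> k -> l <> k ->
         rel_image (R k) (Delta i k `&` Delta k l) = Delta i l)].

End Orthoframes.

(* Main.v *)
Require Import Defs.
From mathcomp Require Import all_boot.
From mathcomp Require Import boolp classical_sets.
Set Implicit Arguments. Unset Strict Implicit. Unset Printing Implicit Defensive.
Local Open Scope classical_set_scope.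

(** A bounded quasi-implication algebra is an orthomodular lattice in disguise:
    the operation is the Sasaki hook [x ⋅ y = x' ∨ (x ∧ y)], so that
    [x ⋅ 0] is the orthocomplement [x'], [x ⋅ y = 1] is the order [x ≤ y],
    [((x ⋅ y) ⋅ x') ⋅ 0] is the meet and [(x' ⋅ y') ⋅ x] is the join.  Under this
    dictionary a filter is a lattice filter and each [◇] is a quantifier: it is
    monotone, increasing and idempotent, and fixes the complement of each of
    its values.

    The monadic condition, the commutation of the relations, the biorthogonal
    closure of the diagonals and the equation between their images all need a
    proper filter to be exhibited.  A single construction supplies it: if [B]
    is nonempty, downward directed and omits [0], its upward closure is a proper
    filter ([up_proper]).
    - With [B = {◇ a | a ∈ α}] this gives the least [R]-successor of [α].  It
      turns a statement on all successors of [α] into the existence of some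
      [a ∈ α], which yields the monadic condition, and it is the intermediate
      point needed to commute [R_i] and [R_k].
    - With [B = {x}] it gives the principal filter of [x ≠ 0].  It shows that
      the orthocomplement of [phi x] is [phi x'] ([orthocompl_phi]), so that
      each [phi x] is biorthogonally closed, and it is the [R]-predecessor that
      shows that [R[phi x] = phi (◇ x)] ([rel_image_phi]), from which the
      diagonal condition is read off the one of the algebra. *)

(** * The orthomodular lattice of a bounded quasi-implication algebra *)

Section BoundedQuasiImplicationAlgebra.
Context {A : Type} (op : A -> A -> A) (zero : A).
Context (bqiA : bounded_quasi_implication_algebra op zero).
Local Notation "x ⋅ y" := (op x y) (at level 40, left associativity).
Local Notation one := (qone op zero).
Local Notation "x ^'" := (op x zero) (at level 1, format "x ^'").
Local Notation "x ≤ y" := (op x y = one) (at level 70).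

Definition qmeet (x y : A) : A := ((x ⋅ y) ⋅ x^')^'.

Lemma qop_absorb x y : (x ⋅ y) ⋅ x = x.
Proof. by case: bqiA => -[]. Qed.

Lemma qop_exchange x y z : (x ⋅ y) ⋅ (x ⋅ z) = (y ⋅ x) ⋅ (y ⋅ z).
Proof. by case: bqiA => -[]. Qed.

Lemma qop_commute x y :
  ((x ⋅ y) ⋅ (y ⋅ x)) ⋅ x = ((y ⋅ x) ⋅ (x ⋅ y)) ⋅ y.
Proof. by case: bqiA => -[]. Qed.

Lemma qle0x x : zero ≤ x.
Proof. by case: bqiA. Qed.

Lemma qop_idl x y : x ⋅ (x ⋅ y) = x ⋅ y.
Proof. by have := qop_absorb (x ⋅ y) x; rewrite (qop_absorb x y). Qed.

Lemma qop_square_absorb x y : (x ⋅ y) ⋅ (x ⋅ x) = x ⋅ x.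
Proof.
by have := qop_exchange x (x ⋅ y) x; rewrite qop_idl !qop_absorb.
Qed.

Lemma qop_square x y : (x ⋅ y) ⋅ (x ⋅ y) = y ⋅ y.
Proof. by rewrite qop_exchange qop_square_absorb. Qed.

(** The square of a product is the square of its right factor, so squaring both
    sides of [qop_commute] identifies the squares of [x] and [y]. *)
Lemma qlexx x : x ≤ x.
Proof.
have := congr1 (fun t => t ⋅ t) (qop_commute x zero).
by rewrite !qop_square.
Qed.

Lemma qlex1 x : x ≤ one.
Proof.
by have := qop_square_absorb (x ⋅ x) x; rewrite qop_absorb !qlexx.
Qed.

Lemma qop1x x : one ⋅ x = x.
Proof. by rewrite -(qlexx x) qop_absorb. Qed.

Lemma qle_anti x y : x ≤ y -> y ≤ x -> x = y.
Proof. by move=> xy yx; have := qop_commute x y; rewrite xy yx !qop1x. Qed.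

Lemma qle_trans y x z : x ≤ y -> y ≤ z -> x ≤ z.
Proof.
by move=> xy yz; have := qop_exchange x y z; rewrite xy yz qop1x qlex1.
Qed.

Lemma qle_opr x y z : y ≤ z -> x ⋅ y ≤ x ⋅ z.
Proof. by move=> yz; rewrite qop_exchange yz qlex1. Qed.

Lemma qlex0 x : x ≤ zero -> x = zero.
Proof. by move=> x0; apply: qle_anti => //; apply: qle0x. Qed.

Lemma qle_compl_op x y : x^' ≤ x ⋅ y.
Proof. exact/qle_opr/qle0x. Qed.

Lemma qcomplK x : x^'^' = x.
Proof. by have := qop_commute x zero; rewrite !qle0x qlex1 !qop1x. Qed.

Lemma qop_opK x y : x ≤ y -> (y ⋅ x) ⋅ x = y.
Proof. by move=> xy; have := qop_commute x y; rewrite xy !qop1x qlex1 qop1x. Qed.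

Lemma qop_op_le x y z : x ≤ y -> (y ⋅ x) ⋅ (y ⋅ z) = x ⋅ z.
Proof. by move=> xy; rewrite -qop_exchange xy qop1x. Qed.

(** Contraposition of the hook.  The left side is [((y ⋅ x) ⋅ y') ⋅ y'], which
    collapses to [y ⋅ x] because [y' ≤ y ⋅ x]. *)
Lemma qop_compl x y : x ≤ y -> x^' ⋅ y^' = y ⋅ x.
Proof.
by move=> xy; rewrite -[x^'](qop_op_le zero xy) qop_opK // qle_compl_op.
Qed.

(** Orthomodularity is what makes this work: the element [w = y' ⋅ x'] has a
    complement lying below both [y] and [y'], and that forces [w' = 0]. *)
Lemma qle_compl x y : x ≤ y -> y^' ≤ x^'.
Proof.
move=> xy; set w := y^' ⋅ x^'.
have wy : w ⋅ y = y.
  have := qop_exchange x^' y^' zero.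
  by rewrite !qcomplK qop_compl // qop_opK.
have w'y : w^' ≤ y by rewrite -[X in _ ⋅ X]wy qle_compl_op.
have w'y' : w^' ≤ y^'.
  by rewrite -[X in _ ⋅ X](qop_absorb y^' x^') qle_compl_op.
have y'w' : y^' ⋅ w^' = y.
  by have := qop_exchange y^' w zero; rewrite qop_idl -/w qcomplK wy qop_absorb => <-.
have yw' : y ⋅ w^' = y^' by rewrite -{1}y'w' qop_opK.
by have := qop_op_le zero w'y; rewrite yw' qlexx qcomplK => <-.
Qed.

(** Contraposing the hook turns [y ⋅ x] into [x' ⋅ y'], which lies above
    [x'' = x]. *)
Lemma qle_op x y : x ≤ y -> x ≤ y ⋅ x.
Proof.
by move=> xy; rewrite -(qop_compl xy) -[X in X ⋅ _]qcomplK qle_compl_op.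
Qed.

(** The contraposed hook is monotone in its right factor, so the hook is
    antitone in its left factor above its right factor. *)
Lemma qle_opl x y z : x ≤ y -> y ≤ z -> z ⋅ x ≤ y ⋅ x.
Proof.
move=> xy yz; rewrite -(qop_compl xy) -(qop_compl (qle_trans xy yz)).
exact/qle_opr/qle_compl.
Qed.

Lemma qmeetC x y : qmeet x y = qmeet y x.
Proof. by rewrite /qmeet qop_exchange. Qed.

Lemma qmeet_lel x y : qmeet x y ≤ x.
Proof. by rewrite -[X in _ ≤ X]qcomplK; apply/qle_compl/qle_op/qle_compl_op. Qed.

Lemma qmeet_ler x y : qmeet x y ≤ y.
Proof. by rewrite qmeetC qmeet_lel. Qed.

(** A lower bound [z] of [x] satisfies [z' = (x ⋅ z) ⋅ x'], to be compared with
    the complement [(x ⋅ y) ⋅ x'] of the meet. *)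
Lemma qle_meet x y z : z ≤ x -> z ≤ y -> z ≤ qmeet x y.
Proof.
move=> zx zy; rewrite -[X in X ≤ _]qcomplK; apply: qle_compl.
rewrite -(qop_op_le zero zx).
by apply: qle_opl; [apply: qle_compl_op | apply: qle_opr].
Qed.

Lemma qmeet_compl x : qmeet x x^' = zero.
Proof. by rewrite /qmeet qop_idl qlexx; apply: qop1x. Qed.

Lemma qjoin_idr x y : x ≤ y -> (x^' ⋅ y^') ⋅ x = y.
Proof. by move=> xy; rewrite qop_compl // qop_opK. Qed.

Lemma qle_joinl x y : x ≤ (x^' ⋅ y^') ⋅ x.
Proof. by apply: qle_op; rewrite -[X in X ⋅ _]qcomplK qle_compl_op. Qed.

(** * Proper filters and their orthogonality *)

Local Notation perp := (@goldblatt_perp A op zero).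
Local Notation filters := (proper_qfilters op zero).
Local Notation phi := (@phi A op zero).

Lemma filter_le (F : filters) x y : sval F x -> x ≤ y -> sval F y.
Proof. by case: F => F [[_ + _] _] /=; apply. Qed.

Lemma filter_meet (F : filters) x y :
  sval F x -> sval F y -> sval F (qmeet x y).
Proof. by case: F => F [[_ _ +] _] /=; apply. Qed.

Lemma filter_not0 (F : filters) : ~ sval F zero.
Proof. by case: F => F []. Qed.

Lemma filter_nonempty (F : filters) : sval F !=set0.
Proof. by case: F => F [[]]. Qed.

Lemma filter1 (F : filters) : sval F one.
Proof. by have [x Fx] := filter_nonempty F; apply: filter_le Fx (qlex1 x). Qed.

Definition up (B : set A) : set A := [set y | exists2 x, B x & x ≤ y].

Lemma up_proper (B : set A) : B !=set0 ->
  (forall x y, B x -> B y -> exists z, [/\ B z, z ≤ x & z ≤ y]) ->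
  ~ B zero -> proper_qfilter op zero (up B).
Proof.
move=> [b Bb] Bdir B0; split; last by move=> [x Bx /qlex0 x0]; apply: B0; rewrite -x0.
split.
- by exists b, b => //; apply: qlexx.
- by move=> x y [z Bz zx] xy; exists z => //; apply: qle_trans xy.
- move=> x y [u Bu ux] [v Bv vy]; have [w [Bw wu wv]] := Bdir u v Bu Bv.
  exists w => //; exact: qle_meet (qle_trans wu ux) (qle_trans wv vy).
Qed.

Lemma principal_filter x : x <> zero ->
  exists F : filters, forall y, sval F y <-> x ≤ y.
Proof.
move=> x0; have upP : proper_qfilter op zero (up [set x]).
  apply: up_proper; first by exists x.
    by move=> _ _ -> ->; exists x; split=> //; apply: qlexx.
  by move=> /esym.
exists (exist _ _ upP) => y /=; split=> [[_ -> //]|xy]; by exists x.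
Qed.

Lemma goldblatt_orthoframe : orthoframe perp.
Proof.
split=> [F [x [Fx Fx']]|F G [x [Fx Gx']]].
  by apply: (@filter_not0 F); have := filter_meet Fx Fx'; rewrite qmeet_compl.
by exists x^'; split=> //; rewrite qcomplK.
Qed.

(** A filter orthogonal to the principal filter of [x] contains some [y] with
    [x ≤ y'], hence contains [x'].  When [x = 0] there is no such principal
    filter, but then [phi x] is empty and [x' = 1]. *)
Lemma orthocompl_phi x : orthocompl perp (phi x) = phi x^'.
Proof.
apply/seteqP; split=> F /=; last first.
  move=> Fx' G Gx; exists x^'; split=> //; by rewrite qcomplK.
have [->|x0] := EM (x = zero); first by move=> _; apply: filter1.
have [G GE] := principal_filter x0; move=> /(_ G) [|y [Fy /GE xy']].
  exact/GE/qlexx.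
by apply: filter_le Fy _; rewrite -[X in X ⋅ _]qcomplK; apply: qle_compl.
Qed.

(** * Quantifiers and accessibility *)

Section Quantifier.
Context (dia : A -> A) (mqiA : monadic_quasi_implication_algebra op zero dia).

Local Notation rel := (fun F G : filters => dia @` sval F `<=` sval G).

Lemma dia_idem_le x : dia (dia x) ≤ dia x.
Proof. by case: mqiA => _ /(_ x) []. Qed.

Lemma le_dia x : x ≤ dia x.
Proof. by case: mqiA => _ /(_ x) []. Qed.

Lemma dia_compl x : dia (dia x)^' = (dia x)^'.
Proof. by case: mqiA. Qed.

Lemma dia0 : dia zero = zero.
Proof. by case: mqiA. Qed.

(** If [x ≤ y] then [y] is the join of [x] and [y], and [dia] preserves
    joins. *)
Lemma dia_le x y : x ≤ y -> dia x ≤ dia y.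
Proof.
move=> xy; have [_ _ _ _ /(_ x y)] := mqiA.
by rewrite qjoin_idr // => ->; apply: qle_joinl.
Qed.

Lemma least_successor (F : filters) : exists G : filters,
  rel F G /\ forall y, sval G y -> exists2 x, sval F x & dia x ≤ y.
Proof.
have upP : proper_qfilter op zero (up (dia @` sval F)).
  apply: up_proper.
  - by have [x Fx] := filter_nonempty F; exists (dia x), x.
  - move=> _ _ [x Fx <-] [y Fy <-]; exists (dia (qmeet x y)); split.
    + by exists (qmeet x y) => //; apply: filter_meet.
    + exact/dia_le/qmeet_lel.
    + exact/dia_le/qmeet_ler.
  - move=> [x Fx x0]; apply: (@filter_not0 F); apply: filter_le Fx _.
    by have := le_dia x; rewrite x0.
exists (exist _ _ upP); split=> [y Fy|y [_ [x Fx <-] xy]]; last by exists x.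
by exists y => //; apply: qlexx.
Qed.

(** If [G] is orthogonal to the least successor of [F] then some [y] in [G]
    lies below [(dia x)'] with [x] in [F].  Since [dia] fixes [(dia x)'], this
    bound persists to [dia y], hence to every successor of [G]. *)
Lemma goldblatt_monadic : monadic_orthoframe perp rel.
Proof.
split; first exact: goldblatt_orthoframe.
- by move=> F _ [x Fx <-]; apply: filter_le Fx (le_dia x).
- move=> F G H FG GH _ [x Fx <-].
  apply: filter_le (dia_idem_le x).
  by apply: GH; exists (dia x) => //; apply: FG; exists x.
- move=> F H [G Gperp GH] K [_ -> FK].
  have [S [FS SE]] := least_successor F.
  have [|y [Gy /SE [x Fx xy']]] := Gperp S; first by exists F.
  have yx : y ≤ (dia x)^' by rewrite -[X in X ⋅ _]qcomplK; apply: qle_compl.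
  exists (dia x)^'; split; last by rewrite qcomplK; apply: FK; exists x.
  apply: (@filter_le _ (dia y)); first by apply: GH; exists y.
  by rewrite -dia_compl; apply: dia_le.
Qed.

(** The principal filter of [x] is an [R]-predecessor of each filter that
    contains [dia x]; such a filter exists only if [x] is nonzero. *)
Lemma rel_image_phi x : rel_image rel (phi x) = phi (dia x).
Proof.
apply/seteqP; split=> G /=; first by move=> [F Fx]; apply; exists x.
move=> Gx; have x0 : x <> zero.
  by move=> x0; move: Gx; rewrite x0 dia0; apply: filter_not0.
have [F FE] := principal_filter x0.
exists F; first exact/FE/qlexx.
by move=> _ [y /FE xy <-]; apply: filter_le Gx (dia_le xy).
Qed.

End Quantifier.

Lemma goldblatt_rel_comp (dia1 dia2 : A -> A) :
    monadic_quasi_implication_algebra op zero dia1 ->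
    monadic_quasi_implication_algebra op zero dia2 ->
    (forall x, dia1 (dia2 x) = dia2 (dia1 x)) ->
  forall F H : filters,
  rel_comp (fun F G : filters => dia1 @` sval F `<=` sval G)
           (fun F G : filters => dia2 @` sval F `<=` sval G) F H ->
  rel_comp (fun F G : filters => dia2 @` sval F `<=` sval G)
           (fun F G : filters => dia1 @` sval F `<=` sval G) F H.
Proof.
move=> m1 m2 d12 F H [G FG GH]; have [K [FK KE]] := least_successor m2 F.
exists K => // _ [y /KE [x Fx xy] <-].
apply: filter_le (dia_le m1 xy).
by rewrite d12; apply: GH; exists (dia1 x) => //; apply: FG; exists x.
Qed.

Lemma phi_meet x y : phi x `&` phi y = phi (qmeet x y).
Proof.
apply/seteqP; split=> F /=; first by move=> [Fx Fy]; apply: filter_meet.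
by move=> Fxy; split; apply: filter_le Fxy _; [apply: qmeet_lel|apply: qmeet_ler].
Qed.

Lemma phi1 : phi one = setT.
Proof. by apply/seteqP; split=> F _ //; apply: filter1. Qed.

End BoundedQuasiImplicationAlgebra.

(** * The Goldblatt frame *)

Theorem theorem4p12 (I A : Type) (op : A -> A -> A) (zero : A)
    (dia : I -> A -> A) (d : I -> I -> A)
    (cylA : cylindric_quasi_implication_algebra op zero dia d) :
  cylindric_orthoframe (@goldblatt_perp A op zero)
    (@goldblatt_rel A op zero I dia) (@goldblatt_diag A op zero I d).
Proof.
case: cylA => mA diaC dC d1 dE.
(* An index is needed to know that the algebra is bounded; every frame
   condition supplies one. *)
have bA (i : I) : bounded_quasi_implication_algebra op zero by case: (mA i).
split.
- by move=> i; apply: goldblatt_monadic (bA i) _ (mA i).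
- move=> i k; apply/funext=> F; apply/funext=> H; apply/propext.
  by split; apply: (goldblatt_rel_comp (bA i)); first [exact: mA | exact: diaC].
- move=> i k; rewrite /goldblatt_diag (dC k i); split=> //.
  by rewrite !(orthocompl_phi (bA i)) (qcomplK (bA i)).
- by move=> i; rewrite /goldblatt_diag d1 (phi1 (bA i)).
- move=> i k l ik lk; rewrite /goldblatt_diag (phi_meet (bA i)) -(dE i k l) //.
  exact: (rel_image_phi (bA i) (mA k)).
Qed.
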